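(* For each $j \in \{5, 6, 7, 8, 9, 10\}$, the hypersurface arrangement $\mathcal{C}_j \subset \mathbb{P}^{14}_{\mathbb{C}}$ defined by $F_j = f_1 f_2 f_3 f_4 f_j = 0$ is free with exponents $(\underbrace{1, \ldots, 1}_{14 \text{ times}})$.
   Context: Let $S = \mathbb{C}[x_1,\ldots,x_5,y_1,\ldots,y_5,z_1,\ldots,z_5]$ be the polynomial ring in 15 variables with its standard grading, the homogeneous coordinate ring of $\mathbb{P}^{14}_{\mathbb{C}}$. Consider the generic matrix $$M = \begin{pmatrix} x_1 & x_2 & x_3 & x_4 & x_5 \\ y_1 & y_2 & y_3 & y_4 & y_5 \\ z_1 & z_2 & z_3 & z_4 & z_5 \end{pmatrix}.$$ For $1 \leq a < b < c \leq 5$ let $\Delta_{abc} \in S$ denote the determinant of the $3\times 3$ submatrix of $M$ formed by columns $a,b,c$ (in this order). Set $f_1 = \Delta_{123}$, $f_2 = \Delta_{124}$, $f_3 = \Delta_{134}$, $f_4 = \Delta_{234}$, $f_5 = \Delta_{125}$, $f_6 = \Delta_{135}$, $f_7 = \Delta_{235}$, $f_8 = \Delta_{145}$, $f_9 = \Delta_{245}$, $f_{10} = \Delta_{345}$. Freeness and exponents: for a reduced homogeneous polynomial $F \in S$ let $\mathrm{AR}(F)$ be the graded $S$-module of Jacobian syzygies, i.e. of all tuples $(a_v)_v \in S^{15}$, indexed by the 15 variables $v$, such that $\sum_v a_v\, \partial F/\partial v = 0$ (a tuple whose entries are homogeneous of degree $e$ has degree $e$). Equivalently, $\mathrm{AR}(F)$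 is the module $D_0$ of polynomial derivations killing $F$. The hypersurface $F = 0$ is called free if $\mathrm{AR}(F)$ is a free $S$-module; its rank is then 14, and its exponents are the multiset $(d_1 \leq \cdots \leq d_{14})$ of degrees of a homogeneous basis, so that $\mathrm{AR}(F) \cong \bigoplus_{i=1}^{14} S(-d_i)$. *)

(* Defs.v *)
From HB Require Import structures.
From mathcomp Require Import all_boot all_order all_algebra.
From mathcomp Require Import reals complex mpoly.

Set Implicit Arguments.
Unset Strict Implicit.
Unset Printing Implicit Defensive.

Import GRing.Theory.
Local Open Scope ring_scope.

(* A finite basis of the submodule N of V over S. *)
Definition is_basis (S : comNzRingType) (V : lmodType S) (N : {pred V})
    (r : nat) (b : 'I_r -> V) : Prop :=
  [/\ forall i, b i \in N,
      forall u, u \in N -> exists c : 'I_r -> S, u = \sum_i c i *: b i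
    & forall c : 'I_r -> S, \sum_i c i *: b i = 0 -> forall i, c i = 0].

(* The S-module of Jacobian syzygies of F, for S = {mpoly K[n]}. *)
Definition AR (K : comNzRingType) (n : nat) (F : {mpoly K[n]}) :
    {pred 'rV[{mpoly K[n]}]_n} :=
  [pred a : 'rV[{mpoly K[n]}]_n | \sum_(v < n) a 0 v * F^`M(v) == 0].

Lemma AR_submod_closed (K : comNzRingType) (n : nat) (F : {mpoly K[n]}) :
  submod_closed (AR F).
Proof.
split=> [|c a b /eqP a0 /eqP b0]; apply/eqP.
  by apply: big1 => v _; rewrite mxE mul0r.
under eq_bigr do rewrite !mxE mulrDl -mulrA.
by rewrite big_split -mulr_sumr /= a0 b0 mulr0 addr0.
Qed.

HB.instance Definition _ (K : comNzRingType) (n : nat) (F : {mpoly K[n]}) :=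
  GRing.isSubmodClosed.Build _ _ (AR F) (AR_submod_closed F).

(* AR F is a submodule of a Noetherian module when K is a field, so only
   finite bases need to be considered. *)
Definition free_hypersurface (K : fieldType) (n : nat) (F : {mpoly K[n]}) :
    Prop :=
  exists (r : nat) (b : 'I_r -> 'rV[{mpoly K[n]}]_n), is_basis (AR F) b.

(* The multiset of exponents is encoded by its nondecreasing enumeration d. *)
Definition has_exponents (K : fieldType) (n : nat) (F : {mpoly K[n]})
    (d : seq nat) : Prop :=
  sorted leq d /\
  exists b : 'I_(size d) -> 'rV[{mpoly K[n]}]_n,
    (forall i v, b i 0 v \is (nth 0%N d i).-homog) /\ is_basis (AR F) b.

(* The rows of this matrix are x, y and z; as mxvec_index enumerates the
   entries row by row, the variables come in the order x_1, ..., x_5,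
   y_1, ..., y_5, z_1, ..., z_5. *)
Definition genericM (K : comNzRingType) : 'M[{mpoly K[3 * 5]}]_(3, 5) :=
  \matrix_(i, j) 'X_(mxvec_index i j).

(* Columns are numbered from 1 to 5; a, b, c are only meant in that range. *)
Definition Delta (K : comNzRingType) (a b c : nat) : {mpoly K[3 * 5]} :=
  \det (\matrix_(i < 3, k < 3)
          genericM K i (inord (nth 0%N [:: a; b; c] k).-1)).

Definition f (K : comNzRingType) (j : nat) : {mpoly K[3 * 5]} :=
  match j with
  | 1 => Delta K 1 2 3
  | 2 => Delta K 1 2 4
  | 3 => Delta K 1 3 4
  | 4 => Delta K 2 3 4
  | 5 => Delta K 1 2 5
  | 6 => Delta K 1 3 5
  | 7 => Delta K 2 3 5
  | 8 => Delta K 1 4 5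
  | 9 => Delta K 2 4 5
  | 10 => Delta K 3 4 5
  | _ => 0
  end.

Definition Fpoly (K : comNzRingType) (j : nat) : {mpoly K[3 * 5]} :=
  f K 1 * f K 2 * f K 3 * f K 4 * f K j.

(* Main.v *)
(* The linear vector fields X |-> A X + X N on 3 x 5 matrices, with A in gl_3
   and N rescaling the columns or adding columns a and b to column 5, preserve
   every factor of F = f_1 f_2 f_3 f_4 Delta_{ab5} up to scalars; modulo the
   scalings acting both as A and as N, 14 of them kill F. Conversely, let a
   vector field u kill F. The minors are pairwise coprime, so u f = h_f f for
   each factor f. Subtracting column scalings makes the h_f equal for
   f_1, ..., f_4; then on columns 1 to 4 the rows of u(M) are syzygies of the
   maximal minors of the generic 3 x 4 matrix, so u(M) = A M there by
   Hilbert-Burch. What is left of u moves only column 5 and, up to a multiple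
   of that column, kills Delta_{ab5}; Hilbert-Burch for the 3 x 2 matrix
   of columns a and b writes it in terms of these columns.

   Coprimality of minors comes from one principle: if f has degree one in a
   variable X_t not occurring in g, it suffices that the coefficient of X_t in
   f be coprime to g. *)
From HB Require Import structures.
Require Import Defs.
From mathcomp Require Import all_boot all_order all_algebra.
From mathcomp Require Import reals complex mpoly.
From mathcomp Require Import ring.

Set Implicit Arguments.
Unset Strict Implicit.
Unset Printing Implicit Defensive.

Import GRing.Theory.
Local Open Scope ring_scope.

(* p is not a zero divisor modulo q; excluding 0 makes this symmetric over an
   integral domain. *)
Definition regular_pair (S : nzRingType) (p q : S) : Prop :=
  [/\ p != 0, q != 0 & forall h k, p * h = q * k -> exists l, h = q * l].

(** * Coprime pairs and logarithmic derivatives *)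

Section RegularPair.
Variable S : idomainType.
Implicit Types p q g : S.

Lemma regular_pair_sym p q : regular_pair p q -> regular_pair q p.
Proof.
move=> [p0 q0 pq]; split=> // h k e; have [l kl] := pq _ _ (esym e).
by exists l; apply: (mulfI q0); rewrite e kl; ring.
Qed.

Lemma regular_pair1l q : q != 0 -> regular_pair 1 q.
Proof.
by move=> q0; split=> // [|h k]; rewrite ?oner_eq0 // mul1r; exists k.
Qed.

Lemma regular_pairNl p q : regular_pair p q -> regular_pair (- p) q.
Proof.
move=> [p0 q0 pq]; split=> // [|h k e]; first by rewrite oppr_eq0.
by apply: (pq h (- k)); rewrite mulrN -e mulNr opprK.
Qed.

Lemma regular_pairMl p q g :
  regular_pair p g -> regular_pair q g -> regular_pair (p * q) g.
Proof.
move=> [p0 g0 pg] [q0 _ qg]; split=> // [|h k]; first by rewrite mulf_neq0.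
by rewrite -mulrA => /pg[l /qg].
Qed.

(** Primes stand for derivatives. All terms but the first are multiples of [p], so [p] divides
    [p' * q * r * s * t], and the four coprime factors cancel. *)
Lemma dvd_log_derivative p q r s t p' q' r' s' t' :
    regular_pair q p -> regular_pair r p -> regular_pair s p ->
    regular_pair t p ->
    p' * q * r * s * t + p * q' * r * s * t + p * q * r' * s * t
      + p * q * r * s' * t + p * q * r * s * t' = 0 ->
  exists h, p' = h * p.
Proof.
move=> qp rp sp tp e.
have [_ _ /(_ p' (- (q' * r * s * t + q * r' * s * t
      + q * r * s' * t + q * r * s * t')))] :=
  regular_pairMl (regular_pairMl (regular_pairMl qp rp) sp) tp.
case=> [|l ->]; last by exists l; rewrite mulrC.
by apply/eqP; rewrite -subr_eq0 -[X in _ == X]e; apply/eqP; ring.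
Qed.

Lemma dvd_log_derivatives p1 p2 p3 p4 p5 q1 q2 q3 q4 q5 :
    regular_pair p1 p2 -> regular_pair p1 p3 -> regular_pair p1 p4 ->
    regular_pair p1 p5 -> regular_pair p2 p3 -> regular_pair p2 p4 ->
    regular_pair p2 p5 -> regular_pair p3 p4 -> regular_pair p3 p5 ->
    regular_pair p4 p5 ->
    (((q1 * p2 + p1 * q2) * p3 + p1 * p2 * q3) * p4 + p1 * p2 * p3 * q4) * p5
      + p1 * p2 * p3 * p4 * q5 = 0 ->
  exists h1 h2 h3 h4 h5, [/\ q1 = h1 * p1, q2 = h2 * p2, q3 = h3 * p3,
    q4 = h4 * p4 & q5 = h5 * p5].
Proof.
move=> r12 r13 r14 r15 r23 r24 r25 r34 r35 r45 e.
have sym := @regular_pair_sym.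
have [|||||h1 e1] := @dvd_log_derivative p1 p2 p3 p4 p5 q1 q2 q3 q4 q5;
  try exact: sym; first by rewrite -[RHS]e; ring.
have [|||||h2 e2] := @dvd_log_derivative p2 p1 p3 p4 p5 q2 q1 q3 q4 q5;
  try exact: sym; try assumption; first by rewrite -[RHS]e; ring.
have [|||||h3 e3] := @dvd_log_derivative p3 p1 p2 p4 p5 q3 q1 q2 q4 q5;
  try exact: sym; try assumption; first by rewrite -[RHS]e; ring.
have [|||||h4 e4] := @dvd_log_derivative p4 p1 p2 p3 p5 q4 q1 q2 q3 q5;
  try exact: sym; try assumption; first by rewrite -[RHS]e; ring.
have [|||||h5 e5] := @dvd_log_derivative p5 p1 p2 p3 p4 q5 q1 q2 q3 q4;
  try exact: sym; try assumption; first by rewrite -[RHS]e; ring.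
by exists h1, h2, h3, h4, h5.
Qed.

(** Descending induction on [i], starting beyond the degree of [h]: in degree [i.+1] the relation
    makes [p * h_i + q * h_(i+1)] a multiple of [g]. *)
Lemma regular_pair_poly p q g (h k : {poly S}) :
  regular_pair p g -> (p%:P * 'X + q%:P) * h = g%:P * k ->
  forall i, exists l, h`_i = g * l.
Proof.
move=> [p0 g0 pg] e i; move: {2}(size h - i)%N (leqnn (size h - i)%N) => n.
elim: n i => [|n IH] i le_n.
  by exists 0; rewrite mulr0 nth_default // -subn_eq0 -leqn0.
have [l hl] : exists l, h`_i.+1 = g * l.
  by apply: IH; rewrite subnS; case: (size h - i)%N le_n => [|m].
apply: (pg _ (k`_i.+1 - q * l)); have := congr1 (fun r : {poly S} => r`_i.+1) e.
rewrite mulrDl -mulrA coefD !coefCM coefXM /= hl => eS.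
by rewrite mulrBr -eS; ring.
Qed.

Lemma coef1_linear p q : (p%:P * 'X + q%:P)`_1 = p.
Proof. by rewrite coefD coefCM coefX coefC addr0 mulr1. Qed.

End RegularPair.

(** * Splitting off one variable *)

Section SplitVariable.
Variables (K : idomainType) (n : nat) (t : 'I_n).
Local Notation S := {mpoly K[n]}.

(* Only the substitution X_t := X is made: the coefficients stay in S, so that
   evaluation at X_t is a left inverse. *)
Definition split_var : S -> {poly S} :=
  mmap (polyC \o @mpolyC n K) (fun i => if i == t then 'X else ('X_i)%:P).

HB.instance Definition _ := GRing.RMorphism.on split_var.

Lemma split_varX i : split_var 'X_i = if i == t then 'X else ('X_i)%:P.
Proof. by rewrite /split_var mmapX mmap1U. Qed.

Lemma split_varB : {morph split_var : p q / p - q}.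
Proof. exact: rmorphB. Qed.

Lemma split_varD : {morph split_var : p q / p + q}.
Proof. exact: rmorphD. Qed.

Lemma split_varM : {morph split_var : p q / p * q}.
Proof. exact: rmorphM. Qed.

Lemma split_varK (p : S) : (split_var p).['X_t] = p.
Proof.
elim/mpolyind: p => [|c m p _ _ IH]; first by rewrite rmorph0 horner0.
rewrite [split_var _]mmapD hornerD; congr (_ + _); last exact: IH.
rewrite mmapZ mmapX hornerM hornerC -mul_mpolyC; congr (_ * _).
rewrite /mmap1 horner_prod [RHS]mpolyXE_id; apply: eq_bigr => i _.
rewrite horner_exp; congr (_ ^+ _).
by case: eqP => [->|_]; rewrite ?hornerX ?hornerC.
Qed.

(** The hypothesis on [g] says that [X_t] does not occur in it. Then [g] divides every coefficient
    of [split_var h], hence also its value [h] at [X_t]. *)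
Lemma regular_pair_linear (f g p q : S) :
    split_var f = p%:P * 'X + q%:P -> split_var g = g%:P ->
    regular_pair p g -> regular_pair f g.
Proof.
move=> fE gE pg; have [p0 g0 _] := pg; split=> // [|h k e].
  apply/eqP => f0; move/eqP: p0; apply.
  by rewrite -(coef1_linear p q) -fE f0 [split_var 0]mmap0 coef0.
have := etrans (esym (split_varM f h))
  (etrans (congr1 split_var e) (split_varM g k)).
rewrite fE gE => /(regular_pair_poly pg) hg; rewrite -[h]split_varK horner_coef.
elim/big_ind: _ => [|_ _ [l ->] [m ->]|i _]; first by exists 0; rewrite mulr0.
  by exists (l + m); rewrite mulrDr.
by have [l ->] := hg i; exists (l * 'X_t ^+ i); rewrite mulrA.
Qed.

End SplitVariable.

(** * Coprimality of minors of the generic matrix *)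

Local Notation i0 := (@Ordinal 3 0 isT).
Local Notation i1 := (@Ordinal 3 1 isT).
Local Notation i2 := (@Ordinal 3 2 isT).

Definition det3 (S : pzRingType) (u v w : 'I_3 -> S) : S :=
  u i0 * (v i1 * w i2 - w i1 * v i2) - v i0 * (u i1 * w i2 - w i1 * u i2)
    + w i0 * (u i1 * v i2 - v i1 * u i2).

Section GenericMinors.
Variable K : idomainType.
Local Notation S := {mpoly K[3 * 5]}.
Implicit Types (p q r : 'I_3) (a b c e g s : 'I_5).

Definition gvar p a : S := 'X_(mxvec_index p a).

Definition gcol a : 'I_3 -> S := gvar^~ a.

Definition minor2 p q a b : S := gvar p a * gvar q b - gvar p b * gvar q a.

Lemma gvar_neq0 p a : gvar p a != 0.
Proof. by rewrite -msupp_eq0 msuppX. Qed.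

Lemma split_gvar p a q b :
  split_var (mxvec_index p a) (gvar q b) =
  if (q == p) && (b == a) then 'X else (gvar q b)%:P.
Proof.
rewrite split_varX; congr (if _ then _ else _); apply/eqP/andP.
  have [f fK _] := curry_mxvec_bij 3 5.
  by move=> /(congr1 f); rewrite (fK (_, _) isT) (fK (_, _) isT) => -[-> ->].
by move=> [/eqP-> /eqP->].
Qed.

Lemma regular_gvar p a q b :
  (p, a) != (q, b) -> regular_pair (gvar p a) (gvar q b).
Proof.
rewrite xpair_eqE => neq.
apply: (@regular_pair_linear _ _ (mxvec_index p a) _ _ 1 0).
- by rewrite split_gvar !eqxx mul1r addr0.
- by rewrite split_gvar [q == _]eq_sym [b == _]eq_sym (negPf neq).
- exact/regular_pair1l/gvar_neq0.
Qed.

Definition split_varE := (split_varB, split_varD, split_varM, split_gvar).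

(** The variable split off lies in row [q], in a column chosen so that its coefficient is, up to
    sign, an entry of row [p] other than [gvar p g]. *)
Lemma regular_minor2_gvar p q a b g : p != q -> a != b ->
  regular_pair (minor2 p q a b) (gvar p g).
Proof.
move=> pq ab; have [->|ga] := eqVneq g a.
  apply: (@regular_pair_linear _ _ (mxvec_index q a) _ _
            (- gvar p b) (gvar p a * gvar q b)).
  - rewrite !split_varE !eqxx (negPf pq) [b == a]eq_sym (negPf ab) /=.
    by ring.
  - by rewrite !split_varE (negPf pq).
  - apply: regular_pairNl; apply: regular_gvar.
    by rewrite xpair_eqE eqxx /= eq_sym.
apply: (@regular_pair_linear _ _ (mxvec_index q b) _ _
            (gvar p a) (- (gvar p b * gvar q a))).
- rewrite !split_varE !eqxx (negPf pq) (negPf ab) /=; by ring.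
- by rewrite !split_varE (negPf pq).
- by apply: regular_gvar; rewrite xpair_eqE eqxx /= eq_sym.
Qed.

Lemma regular_minor2 p q r a b e g :
    p != q -> r != p -> r != q -> a != b -> e != g ->
  regular_pair (minor2 p q a b) (minor2 r p e g).
Proof.
move=> pq rp rq ab eg; apply: regular_pair_sym.
apply: (@regular_pair_linear _ _ (mxvec_index r e) _ _
            (gvar p g) (- (gvar r g * gvar p e))).
- rewrite !split_varE !eqxx [p == r]eq_sym (negPf rp) [g == e]eq_sym.
  by rewrite (negPf eg) /=; ring.
- rewrite /minor2 !split_varE ![_ == r]eq_sym (negPf rp) (negPf rq) /=; by ring.
- exact/regular_pair_sym/regular_minor2_gvar.
Qed.

(** Columns [s] and [c] each occur in one minor only. Splitting off [gvar i0 s], then [gvar i2 c],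
    leaves 2 x 2 minors that share only row [i1]. *)
Lemma regular_minor3_aux s a b c e g :
    uniq [:: s; a; b] -> uniq [:: c; e; g] ->
    s \notin [:: c; e; g] -> c \notin [:: s; a; b] ->
  regular_pair (det3 (gcol s) (gcol a) (gcol b))
    (det3 (gcol c) (gcol e) (gcol g)).
Proof.
rewrite /= !inE !negb_or !andbT -!andbA.
move=> /and3P[sa sb ab] /and3P[ce cg eg] /and3P[sc se sg] /and3P[_ ca cb].
apply: (@regular_pair_linear _ _ (mxvec_index i0 s) _ _ (minor2 i1 i2 a b)
  (- gvar i0 a * minor2 i1 i2 s b + gvar i0 b * minor2 i1 i2 s a)).
- rewrite /det3 /minor2 /gcol !split_varE !eqxx ![_ == s]eq_sym /=.
  by rewrite (negPf sa) (negPf sb); ring.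
- rewrite /det3 /gcol !split_varE ![_ == s]eq_sym (negPf sc) (negPf se).
  by rewrite (negPf sg) /=; ring.
apply: regular_pair_sym.
apply: (@regular_pair_linear _ _ (mxvec_index i2 c) _ _ (minor2 i0 i1 e g)
  (- gvar i2 e * minor2 i0 i1 c g + gvar i2 g * minor2 i0 i1 c e)).
- rewrite /det3 /minor2 /gcol !split_varE !eqxx ![_ == c]eq_sym /=.
  by rewrite (negPf ce) (negPf cg); ring.
- rewrite /minor2 !split_varE ![_ == c]eq_sym (negPf ca) (negPf cb) /=.
  by ring.
exact/regular_pair_sym/regular_minor2.
Qed.

End GenericMinors.

(** * Linear algebra in dimension 3 and Hilbert-Burch *)

Definition dot3 (S : pzRingType) (u v : 'I_3 -> S) : S :=
  u i0 * v i0 + u i1 * v i1 + u i2 * v i2.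

Lemma sum_ord3 (S : nmodType) (F : 'I_3 -> S) :
  \sum_i F i = F i0 + F i1 + F i2.
Proof.
rewrite !big_ord_recr big_ord0 /= add0r.
by congr (F _ + F _ + F _); apply: val_inj.
Qed.

Lemma ord3_ind (P : 'I_3 -> Prop) : P i0 -> P i1 -> P i2 -> forall p, P p.
Proof.
move=> P0 P1 P2 [[|[|[|//]]] lt3]; [move: P0 | move: P1 | move: P2];
  by congr P; apply: val_inj.
Qed.

Lemma det3_rot (S : comPzRingType) (u v w : 'I_3 -> S) :
  det3 u v w = det3 v w u.
Proof. by rewrite /det3; ring. Qed.

Lemma eq_det3 (S : pzRingType) (u u' v v' w w' : 'I_3 -> S) :
  u =1 u' -> v =1 v' -> w =1 w' -> det3 u v w = det3 u' v' w'.
Proof. by move=> eu ev ew; rewrite /det3 !eu !ev !ew. Qed.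

Lemma det_det3 (S : comNzRingType) (A : 'M[S]_3) :
  \det A = det3 (A^~ i0) (A^~ i1) (A^~ i2).
Proof.
(* Indexing by natural numbers identifies the different ordinal terms that the expansions
   produce. *)
pose a i j := A (inord i) (inord j).
have aE i j : A i j = a i j by rewrite /a !inord_val.
rewrite (expand_det_col _ i0) sum_ord3 /cofactor !(expand_det_row _ ord0).
rewrite !big_ord_recl !big_ord0 /cofactor !det_mx11 !mxE !aE /=.
by rewrite /det3 !aE /bump /=; ring.
Qed.

Section HilbertBurch.
Variable S : idomainType.
Implicit Types u v w : 'I_3 -> S.

(** Cramer's rule computes [s] as a fraction from columns 0, 1, 2 (numerators [sg]) and from columns
    0, 1, 3 (numerators [ta]). The relation makes the two agree, and coprimality of the denominators
    makes [s] integral. *)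
Lemma row_span_of_minors u0 u1 u2 u3 (r0 r1 r2 r3 : S) :
    regular_pair (det3 u0 u1 u3) (det3 u0 u1 u2) ->
    r0 * det3 u1 u2 u3 - r1 * det3 u0 u2 u3 + r2 * det3 u0 u1 u3
      - r3 * det3 u0 u1 u2 = 0 ->
  exists s : 'I_3 -> S,
    [/\ r0 = dot3 s u0, r1 = dot3 s u1, r2 = dot3 s u2 & r3 = dot3 s u3].
Proof.
move=> [_ d0 reg] rel.
pose cr (v w : 'I_3 -> S) i j := v i * w j - v j * w i.
pose sg i j := r0 * cr u1 u2 i j - r1 * cr u0 u2 i j + r2 * cr u0 u1 i j.
pose ta i j := r0 * cr u1 u3 i j - r1 * cr u0 u3 i j + r3 * cr u0 u1 i j.
have key i j : (i, j) \in [:: (i1, i2); (i2, i0); (i0, i1)] ->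
    exists l, sg i j = det3 u0 u1 u2 * l.
  move=> ij; apply: (reg _ (ta i j)); apply/eqP; rewrite -subr_eq0.
  rewrite -(mulr0 (cr u0 u1 i j)) -rel /sg /ta /cr /det3; apply/eqP.
  by move: ij; rewrite !inE => /or3P[] /eqP[-> ->]; ring.
have [s0 e0] := key i1 i2 isT; have [s1 e1] := key i2 i0 isT.
have [s2 e2] := key i0 i1 isT; exists (fun p => [:: s0; s1; s2]`_p).
have dE v : det3 u0 u1 u2 * dot3 (fun p : 'I_3 => [:: s0; s1; s2]`_p) v =
   sg i1 i2 * v i0 + sg i2 i0 * v i1 + sg i0 i1 * v i2.
  by rewrite e0 e1 e2 /dot3 /=; ring.
split; apply: (mulfI d0); rewrite dE /sg /cr.
- by rewrite /det3; ring.
- by rewrite /det3; ring.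
- by rewrite /det3; ring.
(* The fourth equation is the relation itself. *)
- by apply/eqP; rewrite -subr_eq0 -oppr_eq0 -rel /det3; apply/eqP; ring.
Qed.

Lemma dot3_eq0 u v w (s : 'I_3 -> S) :
    dot3 s u = 0 -> dot3 s v = 0 -> dot3 s w = 0 -> det3 u v w != 0 ->
  forall p, s p = 0.
Proof.
move=> su sv sw d0 p; apply: (mulIf d0); rewrite mul0r.
pose cr (v w : 'I_3 -> S) i j := v i * w j - v j * w i.
have key i j : dot3 s u * cr v w i j - dot3 s v * cr u w i j
    + dot3 s w * cr u v i j = 0 by rewrite su sv sw !mul0r subrr addr0.
elim/ord3_ind: p; [rewrite -[RHS](key i1 i2) | rewrite -[RHS](key i2 i0)
  | rewrite -[RHS](key i0 i1)]; by rewrite /det3 /dot3 /cr; ring.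
Qed.

(** Cramer's rule again: rows [i0], [i1] and rows [i0], [i2] give the same [a] and [b] with coprime
    denominators. *)
Lemma column_span_of_det3 u v w :
    regular_pair (u i0 * v i2 - v i0 * u i2) (u i1 * v i0 - v i1 * u i0) ->
    det3 u v w = 0 ->
  exists a b, forall p, w p = a * u p + b * v p.
Proof.
move=> [_ d0 reg] rel.
have [a ea] : exists l, w i1 * v i0 - v i1 * w i0 =
    (u i1 * v i0 - v i1 * u i0) * l.
  apply: (reg _ (w i0 * v i2 - v i0 * w i2)); apply/eqP; rewrite -subr_eq0.
  by rewrite -(mulr0 (- v i0)) -rel /det3; apply/eqP; ring.
have [b eb] : exists l, u i1 * w i0 - w i1 * u i0 =
    (u i1 * v i0 - v i1 * u i0) * l.
  apply: (reg _ (u i0 * w i2 - w i0 * u i2)); apply/eqP; rewrite -subr_eq0.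
  by rewrite -(mulr0 (u i0)) -rel /det3; apply/eqP; ring.
exists a, b; elim/ord3_ind; apply: (mulfI d0).
- by rewrite mulrDr !mulrA -ea -eb; ring.
- by rewrite mulrDr !mulrA -ea -eb; ring.
- apply/eqP; rewrite -subr_eq0 mulrDr !mulrA -ea -eb -oppr_eq0 -rel /det3.
  by apply/eqP; ring.
Qed.

End HilbertBurch.

(** * Coprimality of any two distinct maximal minors *)

Section GenericMinors3.
Variable K : idomainType.
Implicit Types (a b c e g h : 'I_5) (T U : seq 'I_5).

Definition minor3 a b c : {mpoly K[3 * 5]} :=
  det3 (gcol K a) (gcol K b) (gcol K c).

(** A cyclic rotation preserves the sign and brings a column outside [U] to the front, as
    [regular_minor3_aux] expects. *)
Lemma minor3_rot_first a b c U : ~~ all (mem U) [:: a; b; c] ->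
  exists s e g, [/\ s \notin U, perm_eq [:: s; e; g] [:: a; b; c]
    & minor3 a b c = minor3 s e g].
Proof.
rewrite -has_predC => /hasP[s /[!inE] /or3P[] /eqP-> sU].
- by exists a, b, c.
- exists b, c, a; split=> //; last exact: det3_rot.
  by rewrite -(perm_rot 2).
- exists c, a, b; split=> //; last by rewrite /minor3 det3_rot det3_rot.
  by rewrite -(perm_rot 1).
Qed.

Lemma regular_minor3 a b c e g h :
    uniq [:: a; b; c] -> uniq [:: e; g; h] ->
    ~~ all (mem [:: e; g; h]) [:: a; b; c] ->
  regular_pair (minor3 a b c) (minor3 e g h).
Proof.
move=> uT uU TU.
(* Two sets of three columns are equal as soon as one contains the other. *)
have UT : ~~ all (mem [:: a; b; c]) [:: e; g; h].
  apply: contra TU => /allP sUT; apply/allP => x.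
  by have [_ TU_eq] := uniq_min_size uU sUT isT; rewrite -TU_eq.
have [s [s' [s'' [sU pT ->]]]] := minor3_rot_first TU.
have [t [t' [t'' [tT pU ->]]]] := minor3_rot_first UT.
apply: regular_minor3_aux; rewrite ?(perm_uniq pT) ?(perm_uniq pU) //.
  by rewrite (perm_mem pU).
by rewrite (perm_mem pT).
Qed.

End GenericMinors3.

Local Notation j0 := (@Ordinal 5 0 isT).
Local Notation j1 := (@Ordinal 5 1 isT).
Local Notation j2 := (@Ordinal 5 2 isT).
Local Notation j3 := (@Ordinal 5 3 isT).
Local Notation j4 := (@Ordinal 5 4 isT).

Lemma ord5_ind (P : 'I_5 -> Prop) :
  P j0 -> P j1 -> P j2 -> P j3 -> P j4 -> forall k, P k.
Proof.
move=> P0 P1 P2 P3 P4 [[|[|[|[|[|//]]]]] lt5];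
  [move: P0 | move: P1 | move: P2 | move: P3 | move: P4];
  by congr P; apply: val_inj.
Qed.

(** * Derivations along a vector field *)

Section Derivation.
Variables (K : comNzRingType) (n : nat) (u : 'rV[{mpoly K[n]}]_n).
Local Notation S := {mpoly K[n]}.

Definition deriv_along (g : S) : S := \sum_(v < n) u 0 v * g^`M(v).

Lemma deriv_alongD : {morph deriv_along : g h / g + h}.
Proof.
move=> g h; rewrite /deriv_along -big_split; apply: eq_bigr => v _ /=.
by rewrite mderivD mulrDr.
Qed.

Lemma deriv_alongB : {morph deriv_along : g h / g - h}.
Proof.
move=> g h; rewrite /deriv_along -sumrB; apply: eq_bigr => v _ /=.
by rewrite mderivB mulrBr.
Qed.

Lemma deriv_alongM g h :
  deriv_along (g * h) = deriv_along g * h + g * deriv_along h.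
Proof.
rewrite /deriv_along mulr_suml mulr_sumr -big_split; apply: eq_bigr => v _ /=.
by rewrite mderivM; ring.
Qed.

Lemma deriv_alongM5 f1 f2 f3 f4 f5 :
  deriv_along (f1 * f2 * f3 * f4 * f5) =
  (((deriv_along f1 * f2 + f1 * deriv_along f2) * f3 + f1 * f2 * deriv_along f3)
    * f4 + f1 * f2 * f3 * deriv_along f4) * f5
  + f1 * f2 * f3 * f4 * deriv_along f5.
Proof. by rewrite !deriv_alongM. Qed.

(** Serves to differentiate [minors_syzygy]. *)
Lemma deriv_along_comb4 f1 f2 f3 f4 g1 g2 g3 g4 :
  deriv_along (f1 * g1 - f2 * g2 + f3 * g3 - f4 * g4) =
  (deriv_along f1 * g1 + f1 * deriv_along g1)
  - (deriv_along f2 * g2 + f2 * deriv_along g2)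
  + (deriv_along f3 * g3 + f3 * deriv_along g3)
  - (deriv_along f4 * g4 + f4 * deriv_along g4).
Proof. by rewrite deriv_alongB deriv_alongD deriv_alongB !deriv_alongM. Qed.

Lemma deriv_along0 : deriv_along 0 = 0.
Proof. by rewrite -[X in deriv_along X](subrr 0) deriv_alongB subrr. Qed.

Lemma deriv_alongX i : deriv_along 'X_i = u 0 i.
Proof.
rewrite /deriv_along (bigD1 i) //= mderivX mnm1E eqxx scale1r.
have -> : (U_(i) - U_(i) = 0 :> 'X_{1..n})%MM.
  by apply/mnmP => k; rewrite mnmBE subnn mnm0E.
rewrite mpolyX0 mulr1 big1 ?addr0 // => v vi.
by rewrite mderivX mnm1E eq_sym (negPf vi) scale0r mulr0.
Qed.

Lemma mem_AR F : (u \in AR F) = (deriv_along F == 0).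
Proof. by []. Qed.

End Derivation.

(** * Linear vector fields acting on a determinant *)

Section AbstractField.
Variable S : comPzRingType.
Implicit Types (A : 'I_3 -> 'I_3 -> S) (u v w : 'I_3 -> S) (c : S).

Definition tr3 A : S := A i0 i0 + A i1 i1 + A i2 i2.

Definition lin_field A c u : 'I_3 -> S := fun p => dot3 (A p) u + c * u p.

(** The determinant is an eigenvector of linear fields; multiples of [u] and [v] added to the third
    column do not change it. *)
Lemma det3_lin_field A cu cv cw al be u v w :
  det3 (lin_field A cu u) v w + det3 u (lin_field A cv v) w
    + det3 u v (fun p => lin_field A cw w p + (al * u p + be * v p)) =
  (tr3 A + cu + cv + cw) * det3 u v w.
Proof. by rewrite /lin_field /det3 /dot3 /tr3; ring. Qed.

(** The weight on [w] is the one giving eigenvalue [h] in [det3_lin_field]. If the field with value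
    [w'] on [w] also has eigenvalue [h], its residue there is coplanar with [u] and [v]. *)
Lemma det3_lin_field_residue A cu cv h u v w w' :
  det3 u v (fun p => w' p - lin_field A (h - tr3 A - cu - cv) w p) =
  det3 (lin_field A cu u) v w + det3 u (lin_field A cv v) w + det3 u v w'
    - h * det3 u v w.
Proof. by rewrite /lin_field /det3 /dot3 /tr3; ring. Qed.

End AbstractField.

(** * Vector fields tangent to the arrangement *)

Section TangentFields.
Variable K : idomainType.
Local Notation S := {mpoly K[3 * 5]}.
Local Notation minor3 := (minor3 K).
Local Notation gcol := (gcol K).
Local Notation gvar := (gvar K).
Implicit Types (u : 'rV[S]_(3 * 5)).

Definition ucol u k : 'I_3 -> S := fun p => u 0 (mxvec_index p k).

Lemma deriv_gvar u p k : deriv_along u (gvar p k) = ucol u k p.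
Proof. exact: deriv_alongX. Qed.

Lemma deriv_minor3 u k l m : deriv_along u (minor3 k l m) =
  det3 (ucol u k) (gcol l) (gcol m) + det3 (gcol k) (ucol u l) (gcol m)
    + det3 (gcol k) (gcol l) (ucol u m).
Proof.
rewrite /minor3 /det3 /gcol.
rewrite !(deriv_alongB, deriv_alongD, deriv_alongM, deriv_gvar).
by ring.
Qed.

Lemma deriv_minor3_lin u (A : 'I_3 -> 'I_3 -> S) k l m ck cl cm :
    ucol u k =1 lin_field A ck (gcol k) ->
    ucol u l =1 lin_field A cl (gcol l) ->
    ucol u m =1 lin_field A cm (gcol m) ->
  deriv_along u (minor3 k l m) = (tr3 A + ck + cl + cm) * minor3 k l m.
Proof.
move=> ek el em; rewrite deriv_minor3 -(det3_lin_field _ _ _ _ 0 0).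
congr (_ + _ + _); apply: eq_det3 => //.
by move=> p; rewrite em !mul0r !addr0.
Qed.

Section Arrangement.
Variables a b : 'I_5.
Hypotheses (ab : a != b) (a4 : a != j4) (b4 : b != j4).

(** The minors f_5 to f_10 are those containing the fifth column, so the other two columns [a] and
    [b] parametrize the six cases. *)
Definition Fpair : S := minor3 j0 j1 j2 * minor3 j0 j1 j3 * minor3 j0 j2 j3
   * minor3 j1 j2 j3 * minor3 a b j4.

Lemma uniq_ab4 : uniq [:: a; b; j4].
Proof. by rewrite /= !inE negb_or ab a4 b4. Qed.

Lemma notin_ab4 x y z : uniq [:: x; y; z] -> j4 \notin [:: x; y; z] ->
  ~~ all (mem [:: a; b; j4]) [:: x; y; z].
Proof.
move=> uT n4; apply/negP => /allP sT.
have [_ eqT] := uniq_min_size uT sT isT.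
by move: n4; rewrite eqT !inE eqxx !orbT.
Qed.

Lemma regular_ab4 x y z : uniq [:: x; y; z] -> j4 \notin [:: x; y; z] ->
  regular_pair (minor3 a b j4) (minor3 x y z) /\
  regular_pair (minor3 x y z) (minor3 a b j4).
Proof.
move=> uT n4; have rg : regular_pair (minor3 x y z) (minor3 a b j4).
  by apply: regular_minor3 => //; [exact: uniq_ab4 | exact: notin_ab4].
by split=> //; apply: regular_pair_sym.
Qed.

(* The fourth column has weight 0, which normalizes away the scalings; so does
   the fifth, whose weight is given by last_weight. *)
Definition diag_weight (c : 'I_3 -> S) (k : 'I_5) : S :=
  [:: c i0; c i1; c i2]`_k.

(* The weights of the five minors under field_entry have sum 0. *)
Definition last_weight (A : 'I_3 -> 'I_3 -> S) (c : 'I_3 -> S) : S :=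
  - (tr3 A *+ 5 + (c i0 + c i1 + c i2) *+ 3
     + (diag_weight c a + diag_weight c b)).

Definition field_entry A (c : 'I_3 -> S) (al be : S) p (k : 'I_5) : S :=
  if k == j4 then lin_field A (last_weight A c) (gcol j4) p
      + (al * gcol a p + be * gcol b p)
  else lin_field A (diag_weight c k) (gcol k) p.

Lemma deriv_Fpair u h1 h2 h3 h4 h5 :
    deriv_along u (minor3 j0 j1 j2) = h1 * minor3 j0 j1 j2 ->
    deriv_along u (minor3 j0 j1 j3) = h2 * minor3 j0 j1 j3 ->
    deriv_along u (minor3 j0 j2 j3) = h3 * minor3 j0 j2 j3 ->
    deriv_along u (minor3 j1 j2 j3) = h4 * minor3 j1 j2 j3 ->
    deriv_along u (minor3 a b j4) = h5 * minor3 a b j4 ->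
  deriv_along u Fpair = (h1 + h2 + h3 + h4 + h5) * Fpair.
Proof.
move=> e1 e2 e3 e4 e5; rewrite /Fpair deriv_alongM5 e1 e2 e3 e4 e5.
by generalize (minor3 j0 j1 j2) (minor3 j0 j1 j3) (minor3 j0 j2 j3)
  (minor3 j1 j2 j3) (minor3 a b j4) => *; ring.
Qed.

Lemma field_mem_AR u A c al be :
    (forall p k, ucol u k p = field_entry A c al be p k) ->
  u \in AR Fpair.
Proof.
move=> uE; have uk k : k != j4 ->
    ucol u k =1 lin_field A (diag_weight c k) (gcol k).
  by move=> k4 p; rewrite uE /field_entry (negPf k4).
rewrite mem_AR; apply/eqP.
have eT := deriv_minor3_lin (uk _ _) (uk _ _) (uk _ _).
have e5 : deriv_along u (minor3 a b j4) = (tr3 A + diag_weight c a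
    + diag_weight c b + last_weight A c) * minor3 a b j4.
  rewrite deriv_minor3 -(det3_lin_field _ _ _ _ al be).
  by congr (_ + _ + _); apply: eq_det3 => //; exact: uk.
rewrite (deriv_Fpair (eT _ _ _ _ _ _) (eT _ _ _ _ _ _) (eT _ _ _ _ _ _)
  (eT _ _ _ _ _ _) e5) // /last_weight.
(* The trace counts in all five minors, each of columns 1 to 3 in three of the first four, and the
   last minor adds the weights of [a], [b] and column 5. *)
rewrite [X in X * _](_ : _ = 0) ?mul0r // /diag_weight /=.
by ring.
Qed.

(** Laplace expansion of a 4 x 4 determinant in which row [p] is repeated. *)
Lemma minors_syzygy p :
  gvar p j0 * minor3 j1 j2 j3 - gvar p j1 * minor3 j0 j2 j3
    + gvar p j2 * minor3 j0 j1 j3 - gvar p j3 * minor3 j0 j1 j2 = 0.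
Proof. by elim/ord3_ind: p; rewrite /minor3 /det3 /gcol; ring. Qed.

Lemma AR_field u : u \in AR Fpair ->
  exists A c al be, forall p k, ucol u k p = field_entry A c al be p k.
Proof.
rewrite mem_AR => /eqP uF.
have [r51 r15] := @regular_ab4 j0 j1 j2 isT isT.
have [r52 r25] := @regular_ab4 j0 j1 j3 isT isT.
have [r53 r35] := @regular_ab4 j0 j2 j3 isT isT.
have [r54 r45] := @regular_ab4 j1 j2 j3 isT isT.
have r12 : regular_pair (minor3 j0 j1 j2) (minor3 j0 j1 j3).
  exact: regular_minor3.
have r13 : regular_pair (minor3 j0 j1 j2) (minor3 j0 j2 j3).
  exact: regular_minor3.
have r14 : regular_pair (minor3 j0 j1 j2) (minor3 j1 j2 j3).
  exact: regular_minor3.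
have r23 : regular_pair (minor3 j0 j1 j3) (minor3 j0 j2 j3).
  exact: regular_minor3.
have r24 : regular_pair (minor3 j0 j1 j3) (minor3 j1 j2 j3).
  exact: regular_minor3.
have r34 : regular_pair (minor3 j0 j2 j3) (minor3 j1 j2 j3).
  exact: regular_minor3.
have [h1 [h2 [h3 [h4 [h5 [e1 e2 e3 e4 e5]]]]]] :=
  dvd_log_derivatives r12 r13 r14 r15 r23 r24 r25 r34 r35 r45
    (etrans (esym (deriv_alongM5 _ _ _ _ _ _)) uF).
have sum_h : h1 + h2 + h3 + h4 + h5 = 0.
  move/eqP: uF; rewrite (deriv_Fpair e1 e2 e3 e4 e5) mulf_eq0 => /orP[/eqP//|].
  have [n1 n5 _] := r15; have [n2 _ _] := r25.
  have [n3 _ _] := r35; have [n4 _ _] := r45.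
  rewrite /Fpair !mulf_eq0 (negPf n1) (negPf n2) (negPf n3).
  by rewrite (negPf n4) (negPf n5).
(* Each of the last three of the four minors omits exactly one of columns 1 to 3; with column 4 of
   weight 0, these weights bring all four eigenvalues to a common value. *)
pose c (q : 'I_3) := [:: h1 - h4; h1 - h3; h1 - h2]`_q.
have rowA p : exists s : 'I_3 -> S,
    [/\ ucol u j0 p - c i0 * gvar p j0 = dot3 s (gcol j0),
        ucol u j1 p - c i1 * gvar p j1 = dot3 s (gcol j1),
        ucol u j2 p - c i2 * gvar p j2 = dot3 s (gcol j2)
      & ucol u j3 p = dot3 s (gcol j3)].
  apply: row_span_of_minors; first exact: regular_pair_sym r12.
  (* In the derivative of the syzygy, the weights [c] absorb the differences between the
     eigenvalues; what is left over is [h1] times the syzygy, which is 0. *)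
  have := congr1 (deriv_along u) (minors_syzygy p).
  rewrite deriv_along_comb4 !deriv_gvar e1 e2 e3 e4 deriv_along0 => Ep.
  rewrite -/(minor3 j1 j2 j3) -/(minor3 j0 j2 j3) -/(minor3 j0 j1 j3).
  rewrite -/(minor3 j0 j1 j2) -[RHS](subr0 0) -[in X in _ = X - _]Ep.
  rewrite -[X in _ = _ - X](mulr0 h1) -(minors_syzygy p) /c /=.
  generalize (minor3 j0 j1 j2) (minor3 j0 j1 j3) (minor3 j0 j2 j3)
    (minor3 j1 j2 j3) => *; by ring.
have [A AE] := fin_all_exists rowA.
have uk k : k != j4 -> ucol u k =1 lin_field A (diag_weight c k) (gcol k).
  elim/ord5_ind: k => // _ p; have [E0 E1 E2 E3] := AE p;
    rewrite /lin_field /diag_weight -?E0 -?E1 -?E2 -?E3 /gcol ?subrK //.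
  by rewrite mul0r addr0.
have eT := deriv_minor3_lin (uk _ _) (uk _ _) (uk _ _).
have trE : h1 = tr3 A + c i0 + c i1 + c i2.
  have [n1 _ _] := r15; apply: (mulIf n1); rewrite -e1.
  exact: eT.
(* The weight of column 5 that the eigenvalue [h5] forces; it agrees with [last_weight] because the
   eigenvalues sum to 0. *)
pose e := h5 - tr3 A - diag_weight c a - diag_weight c b.
have eE : e = last_weight A c.
  have tE : tr3 A = h1 - c i0 - c i1 - c i2 by rewrite trE; ring.
  rewrite /e /last_weight tE; apply/eqP; rewrite -subr_eq0 -[X in _ == X]sum_h.
  by rewrite /c /=; apply/eqP; ring.
have [al [be wE]] : exists al be, forall p,
    ucol u j4 p - lin_field A e (gcol j4) p = al * gcol a p + be * gcol b p.
  apply: column_span_of_det3.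
    by apply: regular_minor2.
  rewrite /e det3_lin_field_residue -[h5 * _]e5 deriv_minor3.
  rewrite (eq_det3 (uk a a4) (frefl (gcol b)) (frefl (gcol j4))).
  rewrite (eq_det3 (frefl (gcol a)) (uk b b4) (frefl (gcol j4))).
  exact: subrr.
exists A, c, al, be => p k; rewrite /field_entry; case: eqP => [->|/eqP k4].
  by rewrite -eE -wE addrC subrK.
exact: uk.
Qed.

(** Yields the independence of the 14 fields. Comparing four minors kills the weights and the trace;
    Cramer's rule then kills [A], and finally [al] and [be]. *)
Lemma field_entry_inj A c al be :
    (forall p k, field_entry A c al be p k = 0) ->
  [/\ forall p q, A p q = 0, forall q, c q = 0, al = 0 & be = 0].
Proof.
move=> z; have zk k : k != j4 ->
    ucol 0 k =1 lin_field A (diag_weight c k) (gcol k).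
  move=> k4 p; have := z p k; rewrite /field_entry (negPf k4) => ->.
  by rewrite /ucol mxE.
have D0 g : deriv_along (0 : 'rV[S]_(3 * 5)) g = 0.
  by rewrite /deriv_along big1 // => v _; rewrite mxE mul0r.
(* The zero field has eigenvalue 0 on every minor, and the minors are nonzero. *)
have eT x y t : x != j4 -> y != j4 -> t != j4 -> uniq [:: x; y; t] ->
    j4 \notin [:: x; y; t] ->
    tr3 A + diag_weight c x + diag_weight c y + diag_weight c t = 0.
  move=> x4 y4 t4 uT n4; have := deriv_minor3_lin (zk x x4) (zk y y4) (zk t t4).
  rewrite D0 => /esym/eqP; rewrite mulf_eq0 => /orP[/eqP//|].
  by case: (@regular_ab4 x y t uT n4) => _ [n _ _]; rewrite (negPf n).
have t1 := eT j0 j1 j2 isT isT isT isT isT.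
have t2 := eT j0 j1 j3 isT isT isT isT isT.
have t3 := eT j0 j2 j3 isT isT isT isT isT.
have t4 := eT j1 j2 j3 isT isT isT isT isT.
rewrite /diag_weight /= ?addr0 in t1 t2 t3 t4.
have c0 q : c q = 0.
  elim/ord3_ind: q.
  - by rewrite -(subrr 0) -[X in _ = X - _]t1 -[X in _ = _ - X]t4; ring.
  - by rewrite -(subrr 0) -[X in _ = X - _]t1 -[X in _ = _ - X]t3; ring.
  - by rewrite -(subrr 0) -[X in _ = X - _]t1 -[X in _ = _ - X]t2; ring.
have w0 k : diag_weight c k = 0.
  by elim/ord5_ind: k; rewrite /diag_weight /= ?c0.
have tr0 : tr3 A = 0 by move: t1; rewrite !c0 !addr0.
have Ak p k : k != j4 -> dot3 (A p) (gcol k) = 0.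
  by move=> k4; have := zk k k4 p; rewrite /ucol mxE /lin_field w0 mul0r addr0.
have A0 p q : A p q = 0.
  have [_ [n _ _]] := @regular_ab4 j0 j1 j2 isT isT.
  by apply: (dot3_eq0 (Ak p j0 isT) (Ak p j1 isT) (Ak p j2 isT)).
have l0 p : al * gvar p a + be * gvar p b = 0.
  have := z p j4; rewrite /field_entry eqxx /lin_field /last_weight !w0 !c0 tr0.
  by rewrite !addr0 !mul0rn !addr0 oppr0 mul0r addr0 /dot3 !A0 !mul0r !add0r.
(* Only the nonvanishing of the 2 x 2 minor in rows [i0], [i1] is extracted. *)
have [n2 _ _] := @regular_minor2 K i0 i1 i2 a b a b isT isT isT ab ab.
split=> //; apply: (mulIf n2); rewrite mul0r.
  transitivity ((al * gvar i0 a + be * gvar i0 b) * gvar i1 b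
                - (al * gvar i1 a + be * gvar i1 b) * gvar i0 b).
    by rewrite /minor2; ring.
  by rewrite !l0 !mul0r subrr.
transitivity ((al * gvar i1 a + be * gvar i1 b) * gvar i0 a
              - (al * gvar i0 a + be * gvar i0 b) * gvar i1 a).
  by rewrite /minor2; ring.
by rewrite !l0 !mul0r subrr.
Qed.

End Arrangement.
End TangentFields.

(** * The basis as the image of the standard basis under a linear parametrization *)

Lemma is_basis_linear (S : comNzRingType) (V : lmodType S) (N : {pred V})
    (r : nat) (T : {linear 'rV[S]_r -> V}) :
    (forall C, T C \in N) -> (forall u, u \in N -> exists C, u = T C) ->
    (forall C, T C = 0 -> C = 0) ->
  is_basis N (fun i => T (delta_mx 0 i)).
Proof.
move=> TN Tsurj Tinj; have TE (C : 'rV[S]_r) :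
    T C = \sum_i C 0 i *: T (delta_mx 0 i).
  rewrite [in LHS](row_sum_delta C) linear_sum; apply: eq_bigr => i _.
  exact: linearZ.
split=> [i|u /Tsurj[C ->]|c c0]; first exact: TN.
  by exists (C 0); exact: TE.
move=> i; have /Tinj/rowP/(_ i) : T (\row_i c i) = 0.
  by rewrite TE -[RHS]c0; apply: eq_bigr => k _; rewrite mxE.
by rewrite !mxE.
Qed.

Section Parametrization.
Variables (K : idomainType) (a b : 'I_5).
Local Notation S := {mpoly K[3 * 5]}.
Implicit Type C : 'rV[S]_(3 * 3 + 3 + 2).

(* 14 = 9 + 3 + 2 parameters: a matrix in gl_3, the weights of columns 1 to 3,
   and the multiples of columns a and b added to column 5. *)
Definition par_mx C p q : S := C 0 (lshift 2 (lshift 3 (mxvec_index p q))).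
Definition par_diag C q : S := C 0 (lshift 2 (rshift (3 * 3) q)).
Definition par_col C k : S := C 0 (rshift (3 * 3 + 3) k).

Definition param_field C : 'rV[S]_(3 * 5) :=
  mxvec (\matrix_(p, k) field_entry a b (par_mx C) (par_diag C)
           (par_col C ord0) (par_col C ord_max) p k).

Lemma ucol_param_field C p k : ucol (param_field C) k p =
  field_entry a b (par_mx C) (par_diag C)
    (par_col C ord0) (par_col C ord_max) p k.
Proof. by rewrite /ucol mxvecE mxE. Qed.

Lemma param_field_is_linear : linear param_field.
Proof.
move=> x C D; rewrite /param_field -linearP; congr mxvec; apply/matrixP => p k.
rewrite !mxE /field_entry /lin_field /last_weight /dot3 /tr3.
have Ep q r : par_mx (x *: C + D) q r = x * par_mx C q r + par_mx D q r.
  by rewrite /par_mx !mxE.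
have Ed q : par_diag (x *: C + D) q = x * par_diag C q + par_diag D q.
  by rewrite /par_diag !mxE.
have Ec q : par_col (x *: C + D) q = x * par_col C q + par_col D q.
  by rewrite /par_col !mxE.
have Ew q : diag_weight (par_diag (x *: C + D)) q =
    x * diag_weight (par_diag C) q + diag_weight (par_diag D) q.
  by elim/ord5_ind: q; rewrite /diag_weight /= ?Ed // mulr0 addr0.
by rewrite !Ep !Ed !Ec !Ew; case: ifP => _; ring.
Qed.

HB.instance Definition _ :=
  GRing.isLinear.Build _ _ _ _ param_field param_field_is_linear.

Lemma param_field_homog C :
  (forall i, C 0 i \is 0.-homog) -> forall i, param_field C 0 i \is 1.-homog.
Proof.
move=> C0 i; case/mxvec_indexP: i => p k; rewrite mxvecE mxE.
have X1 q l : gvar K q l \is 1.-homog.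
  by rewrite dhomogX; apply/eqP; exact: mdeg1.
have M1 (x : S) q l : x \is 0.-homog -> x * gvar K q l \is 1.-homog.
  by move=> x0; apply: (dhomogM x0).
have w0 l : diag_weight (par_diag C) l \is 0.-homog.
  by elim/ord5_ind: l; rewrite /diag_weight /= ?C0 ?rpred0.
have lin1 c l : c \is 0.-homog ->
    lin_field (par_mx C) c (gcol K l) p \is 1.-homog.
  by move=> c0; rewrite /lin_field /dot3 !rpredD ?M1 ?C0.
rewrite /field_entry; case: ifP => _; last exact: lin1.
apply: rpredD; last by rewrite rpredD ?M1 ?C0.
apply: lin1; rewrite /last_weight rpredN.
by rewrite !rpredD ?rpredMn ?rpredD ?w0 ?C0.
Qed.

Lemma Fpair_basis : a != b -> a != j4 -> b != j4 ->
  is_basis (AR (Fpair K a b)) (fun i => param_field (delta_mx 0 i)).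
Proof.
move=> ab a4 b4; apply: is_basis_linear => [C|u|C C0].
- exact/field_mem_AR/ucol_param_field.
- move=> /(AR_field ab a4 b4)[A [c [al [be uE]]]].
  (* The blocks follow the layout read by [par_mx], [par_diag] and [par_col]. *)
  exists (row_mx (row_mx (mxvec (\matrix_(p, q) A p q)) (\row_q c q))
            (\row_k [:: al; be]`_k)).
  apply/rowP => i; case/mxvec_indexP: i => p k; rewrite -/(ucol u k p) uE.
  rewrite -[RHS]/(ucol _ _ _) ucol_param_field.
  set C := row_mx _ _.
  have eA q r : par_mx C q r = A q r.
    by rewrite /par_mx /C !row_mxEl mxvecE mxE.
  have ec q : par_diag C q = c q.
    by rewrite /par_diag /C row_mxEl row_mxEr mxE.
  have e0 : par_col C ord0 = al by rewrite /par_col /C row_mxEr mxE.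
  have e1 : par_col C ord_max = be by rewrite /par_col /C row_mxEr mxE.
  rewrite /field_entry /lin_field /last_weight /diag_weight /tr3 /dot3.
  by rewrite !eA !ec e0 e1.
- have [|A0 c0 al0 be0] := @field_entry_inj K a b ab a4 b4 (par_mx C)
    (par_diag C) (par_col C ord0) (par_col C ord_max).
    by move=> p k; rewrite -ucol_param_field C0 /ucol mxE.
  apply/rowP => i; rewrite mxE; case: (split_ordP i) => [l ->|k ->].
    case: (split_ordP l) => [m ->|q ->]; last exact: c0.
    by case/mxvec_indexP: m => p q; exact: A0.
  case: k => [[|[|//]] lt2]; [rewrite -[RHS]al0 | rewrite -[RHS]be0];
    by congr (C 0 (rshift _ _)); apply: val_inj.
Qed.

End Parametrization.

(** * Return to the polynomials F_j *)

Lemma Delta_minor3 (K : idomainType) (k l m : 'I_5) :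
  Delta K k.+1 l.+1 m.+1 = minor3 K k l m.
Proof.
rewrite /Delta det_det3; apply: eq_det3 => p; rewrite !mxE /=;
  by congr 'X_(mxvec_index _ _); rewrite inord_val.
Qed.

Lemma Fpoly_Fpair (K : idomainType) j : (5 <= j <= 10)%N ->
  exists a b, [/\ a != b, a != j4, b != j4 & Fpoly K j = Fpair K a b].
Proof.
have FE k a b : f K k = minor3 K a b j4 -> Fpoly K k = Fpair K a b.
  move=> fk; rewrite /Fpoly /Fpair fk.
  rewrite (Delta_minor3 K j0 j1 j2 : f K 1 = _).
  rewrite (Delta_minor3 K j0 j1 j3 : f K 2 = _).
  rewrite (Delta_minor3 K j0 j2 j3 : f K 3 = _).
  by rewrite (Delta_minor3 K j1 j2 j3 : f K 4 = _).
have D := Delta_minor3 K.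
case: j => [|[|[|[|[|[|[|[|[|[|[|j]]]]]]]]]]] // _.
- by exists j0, j1; split=> //; apply: FE; exact: (D j0 j1 j4).
- by exists j0, j2; split=> //; apply: FE; exact: (D j0 j2 j4).
- by exists j1, j2; split=> //; apply: FE; exact: (D j1 j2 j4).
- by exists j0, j3; split=> //; apply: FE; exact: (D j0 j3 j4).
- by exists j1, j3; split=> //; apply: FE; exact: (D j1 j3 j4).
- by exists j2, j3; split=> //; apply: FE; exact: (D j2 j3 j4).
Qed.

Theorem theorem1p4 (R : realType) (j : nat) (hj : (5 <= j <= 10)%N) :
  free_hypersurface (Fpoly R[i] j) /\ has_exponents (Fpoly R[i] j) (nseq 14 1%N).
Proof.
have [a [b [ab a4 b4 ->]]] := Fpoly_Fpair R[i] hj.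
have basis := Fpair_basis R[i] ab a4 b4.
split; first by exists 14, (fun i => param_field a b (delta_mx 0 i)).
split=> //; exists (fun i => param_field a b (delta_mx 0 i)); split=> // i v.
rewrite nth_nseq; case: ifP => [_|/negP[]]; last exact: ltn_ord.
(* Standard basis vectors have constant entries, so the fields are linear. *)
apply: param_field_homog => k; rewrite mxE.
by case: (_ && _); [exact: dhomog1 | exact: dhomog0].
Qed.
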